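(* Let $c_1>0$ and let $b:[0,c_1]\to\mathbb R$ be Lipschitz continuous with $b(0)=1$. Let $c<d$. Then there is a constant $C_2>0$ such that for all $R>|c|+|d|$ and all $f\in C^{1/2}_c(c,d)$, $$\Big\|\sup_{a\in[0,c_1]}|L_af|\Big\|_{L^\infty[-R,R]}\le C_2(1+|d-c|)R^{1/2}\|f\|_{C^{1/2}_c(c,d)}.$$
   Context: For $a>0$ and $f\in L^1(\mathbb R)$, $L_af(u)=\frac{1}{\sqrt{2\pi}}\frac{e^{i\pi/4}}{\sqrt{2a}}\int_{\mathbb R}f(t)e^{-i\frac{(b(a)u-t)^2}{4a}}dt$, and $L_0f(u)=f(b(0)u)=f(u)$; for Schwartz $f$ this equals $\frac1{\sqrt{2\pi}}\int_{\mathbb R}e^{i[b(a)uv+av^2]}\hat f(v)dv$ with $\hat f(v)=\frac1{\sqrt{2\pi}}\int e^{-ivt}f(t)dt$. $C^{s}_c(c,d)$ denotes the space of (complex-valued) functions on $\mathbb R$ supported in $(c,d)$ which are Hölder continuous of exponent $s$, with norm $\|f\|_{C^s_c(c,d)}=\sup|f|+\sup_{x\ne y}\frac{|f(x)-f(y)|}{|x-y|^s}$. *)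

(* Defs.v *)
From HB Require Import structures.
From mathcomp Require Import all_boot all_order all_algebra.
From mathcomp Require Import all_classical all_reals all_analysis.
From mathcomp Require Import complex.
From mathcomp Require Import ess_sup_inf.

Set Implicit Arguments.
Unset Strict Implicit.
Unset Printing Implicit Defensive.

Import Order.TTheory GRing.Theory Num.Def Num.Theory.
Import numFieldNormedType.Exports.

Local Open Scope classical_set_scope.
Local Open Scope ring_scope.

Section defs.
Variable R : realType.

Definition cexpi (theta : R) : R[i] := Complex (cos theta) (sin theta).

Definition cint (g : R -> R[i]) : R[i] :=
  Complex (\int[lebesgue_measure]_(t in [set: R]) complex.Re (g t))
          (\int[lebesgue_measure]_(t in [set: R]) complex.Im (g t)).

Definition La (b : R -> R) (a : R) (f : R -> R[i]) (u : R) : R[i] :=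
  if a == 0 then f (b 0 * u)
  else Complex (Num.sqrt (2 * pi))^-1 0 * cexpi (pi / 4) * Complex (Num.sqrt (2 * a))^-1 0
       * cint (fun t => f t * cexpi (- ((b a * u - t) ^+ 2 / (4 * a)))).

Definition cmod (z : R[i]) : R := ComplexField.Normc.normc z.

Definition holder_cont (s : R) (f : R -> R[i]) : Prop :=
  exists K : R, forall x y : R, cmod (f x - f y) <= K * (`|x - y| `^ s).

(* supp f is a (compact) subset of the open interval (c,d) *)
Definition supported_in (c d : R) (f : R -> R[i]) : Prop :=
  exists c' d' : R, c < c' /\ d' < d /\
    forall x : R, (x < c' \/ d' < x) -> f x = 0.

Definition in_Cs_c (s c d : R) (f : R -> R[i]) : Prop :=
  supported_in c d f /\ holder_cont s f.

Definition Cs_norm (s : R) (f : R -> R[i]) : R :=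
  sup [set cmod (f x) | x in [set: R]]
  + sup [set cmod (f xy.1 - f xy.2) / (`|xy.1 - xy.2| `^ s) |
           xy in [set xy : R * R | xy.1 != xy.2]].

Definition lipschitz_on_set (A : set R) (b : R -> R) : Prop :=
  exists L : R, forall x y, A x -> A y -> `|b x - b y| <= L * `|x - y|.

Lemma measurable_cc (r : R) : measurable `[- r, r]%classic.
Proof. exact: measurable_itv. Qed.

Definition Linf_on (r : R) (g : R -> \bar R) : \bar R :=
  ess_sup (mrestr lebesgue_measure (measurable_cc r)) g.

Definition maxLa (b : R -> R) (c1 : R) (f : R -> R[i]) (u : R) : \bar R :=
  ereal_sup [set (cmod (La b a f u))%:E | a in `[0, c1]%classic].

End defs.

(* Main.v *)
Require Import Defs.
From HB Require Import structures.
From mathcomp Require Import all_boot all_order all_algebra.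
From mathcomp Require Import all_classical all_reals all_analysis.
From mathcomp Require Import complex.
From mathcomp Require Import ess_sup_inf.
From mathcomp Require Import ring lra.
Import Order.TTheory GRing.Theory Num.Def Num.Theory.
Import numFieldNormedType.Exports.
Local Open Scope classical_set_scope.
Local Open Scope ring_scope.

(* With [x = b a * u], [|La b a f u|] is a constant times [a ^ (-1/2)] times the
   modulus of the integral of [f] against [exp (- i (x - t) ^ 2 / (4 a))]. Cut
   the line at the points [x +- sigma sqrt k], [sigma = sqrt (8 pi a)], where the
   phase is [2 pi k]. On the piece [P <= |t - x| <= Q] freeze [f] at an
   endpoint: the error is at most [||f|| (Q - P) ^ (3/2)], and one integration
   by parts, whose boundary terms cancel over a full period, bounds the
   integral of the exponential by [O (sigma ^ 2 (Q - P) / P ^ 2)]. Since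
   [Q ^ 2 - P ^ 2 = sigma ^ 2], both bounds telescope, to
   [O (sigma sqrt Q)] and [O (sigma)]; the factor [sigma] absorbs
   [a ^ (-1/2)], and the last [Q] needed to cover the support is [O (r)]. *)

(** * Real integrals over segments *)

Section oscillatory_integrals.
Set Implicit Arguments.
Unset Strict Implicit.
Variable R : realType.
Local Notation mu := (@lebesgue_measure R).

Lemma integrable_itvcc (g : R -> R) (p q : R) :
  {within `[p, q], continuous g} -> mu.-integrable `[p, q] (EFin \o g).
Proof.
by move=> cg; apply: continuous_compact_integrable => //; exact: segment_compact.
Qed.

Lemma Rintegral_itvcc_cat (g : R -> R) (p q s : R) : continuous g ->
  p <= q -> q <= s ->
  \int[mu]_(t in `[p, s]) g t =
  \int[mu]_(t in `[p, q]) g t + \int[mu]_(t in `[q, s]) g t.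
Proof.
move=> cg pq qs.
have ig u v : mu.-integrable `[u, v] (EFin \o g).
  by apply: integrable_itvcc; exact: continuous_subspaceT.
have := @Rintegral_itvB R g (BLeft p) (BRight s) q (ig p s).
rewrite !bnd_simp => /(_ pq qs) /eqP; rewrite subr_eq addrC => /eqP ->.
congr (_ + _); apply: Rintegral_itv_obnd_cbnd.
by apply: integrableS (ig q s) => //; exact: subset_itv_oc_cc.
Qed.

Lemma normr_Rintegral_le (g : R -> R) (p q B : R) : p <= q ->
  {within `[p, q], continuous g} ->
  (forall t, p <= t <= q -> `|g t| <= B) ->
  `|\int[mu]_(t in `[p, q]) g t| <= B * (q - p).
Proof.
move=> pq cg gB; have ig := integrable_itvcc cg.
apply: (le_trans (le_normr_Rintegral _ ig)) => //.
have -> : B * (q - p) = \int[mu]_(t in `[p, q]) cst B t.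
  rewrite Rintegral_cst//= lebesgue_measure_itv/= lte_fin.
  move: pq; rewrite le_eqVlt => /predU1P[->|pq]; last by rewrite pq.
  by rewrite ltxx !subrr.
apply: le_Rintegral => //.
- exact: (integrable_norm ig).
- by apply: integrable_itvcc; apply: continuous_subspaceT => ?; apply: cvg_cst.
Qed.

(** * Oscillatory integrals with a quadratic phase *)

Section quadratic_phase.
(* [(S, W)] will be [(sin, cos)] and [(1 - cos, sin)]. *)
Variables (S W : R -> R).
Hypothesis dS : forall y : R, is_derive y 1 S (W y).
Hypothesis cW : continuous W.
Hypothesis W1 : forall y, `|W y| <= 1.
Hypothesis S2 : forall y, `|S y| <= 2.
Hypothesis S0 : forall k : nat, S (k%:R * (2 * pi)) = 0.
Variables (x a : R).
Hypothesis a0 : 0 < a.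

Definition qphase (t : R) : R := (x - t) ^+ 2 / (4 * a).

Lemma continuous_qphase : continuous qphase.
Proof.
move=> t; apply: cvgM; last exact: cvg_cst.
under eq_fun do rewrite expr2.
rewrite expr2; apply: cvgM; (apply: cvgB; [exact: cvg_cst|exact: cvg_id]).
Qed.

Lemma continuous_Wqphase : continuous (W \o qphase).
Proof. by move=> t; apply: continuous_comp; [exact: continuous_qphase|exact: cW]. Qed.

Lemma continuous_Sqphase : continuous (S \o qphase).
Proof.
move=> t; apply: continuous_comp; first exact: continuous_qphase.
by apply: differentiable_continuous; apply/derivable1_diffP; exact: ex_derive.
Qed.

(** This is the integration by parts in differential form: [2 * a / (t - x)] is the inverse of the
    derivative of [qphase], and the subtracted term comes from differentiating that inverse. *)
Lemma is_derive_qprimitive (t : R) : t != x ->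
  is_derive t 1 (fun t => S (qphase t) * (2 * a / (t - x)))
    (W (qphase t) - S (qphase t) * (2 * a / (t - x) ^+ 2)).
Proof.
move=> tx.
have dphi : is_derive t 1 qphase ((t - x) / (2 * a)).
  rewrite /qphase; apply: is_derive_eq.
  by rewrite /GRing.scale/=; field; rewrite gt_eqF.
have dSphi := @is_derive1_comp _ S qphase t _ _ (dS (qphase t)) dphi.
have txn : t - x != 0 by rewrite subr_eq0.
apply: is_derive_eq.
by rewrite /GRing.scale/=; field; rewrite txn gt_eqF.
Qed.

(* Over a full period the boundary terms of [S / phase'] vanish. *)
Lemma Wqphase_period (p q m : R) : p < q -> 0 < m ->
  (forall t, p <= t <= q -> m <= `|t - x|) ->
  S (qphase p) = 0 -> S (qphase q) = 0 ->
  `|\int[mu]_(t in `[p, q]) W (qphase t)| <= 4 * a / m ^+ 2 * (q - p).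
Proof.
move=> pq m0 mtx Sp Sq.
pose r t := S (qphase t) * (2 * a / (t - x) ^+ 2).
have tx t : p <= t <= q -> t != x.
  move=> /mtx; apply: contraTneq => ->.
  by rewrite subrr normr0 -ltNge.
have cr t : t \in [set` `[p, q]] -> {for t, continuous r}.
  rewrite inE/= in_itv/= => /tx tnx.
  apply: cvgM; first exact: continuous_Sqphase.
  apply: cvgM; first exact: cvg_cst.
  apply: cvgV; first by rewrite sqrf_eq0 subr_eq0.
  under eq_fun do rewrite expr2.
  rewrite expr2; apply: cvgM; (apply: cvgB; [exact: cvg_id|exact: cvg_cst]).
have cWp : {within `[p, q], continuous (W \o qphase)}.
  by apply: continuous_subspaceT; exact: continuous_Wqphase.
pose F t := S (qphase t) * (2 * a / (t - x)).
have dF t : p <= t <= q -> is_derive t 1 F (W (qphase t) - r t).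
  by move=> /tx; exact: is_derive_qprimitive.
have cF t : p <= t <= q -> {for t, continuous F}.
  by move=> /dF[/derivable1_diffP + _]; exact: differentiable_continuous.
(* Since [S] vanishes at the phases of both endpoints, so does [F]; hence the integral of
   [W \o qphase] equals that of the remainder [r], which is then estimated pointwise. *)
have : \int[mu]_(t in `[p, q]) (W (qphase t) - r t) = F q - F p.
  rewrite /Rintegral (@continuous_FTC2 _ (fun t => W (qphase t) - r t) F p q)//.
  - apply: continuous_in_subspaceT => t tpq.
    by apply: cvgB; [exact: continuous_Wqphase|exact: cr].
  - split.
    + move=> t; rewrite in_itv/= => /andP[pt tq].
      by have [] := dF t _; rewrite ?(ltW pt) ?(ltW tq).
    + apply: cvg_at_right_filter; apply: cF; rewrite lexx ltW//.
    + apply: cvg_at_left_filter; apply: cF; rewrite lexx ltW//.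
  - move=> t; rewrite in_itv/= => /andP[pt tq].
    rewrite derive1E; apply: derive_val; apply: dF.
    by rewrite (ltW pt) (ltW tq).
have {}cr := continuous_in_subspaceT cr.
rewrite RintegralB//; [|exact: integrable_itvcc..].
rewrite {1 2}/F Sp Sq !mul0r subrr => /eqP; rewrite subr_eq0 => /eqP ->.
apply: normr_Rintegral_le => //; first exact: ltW.
move=> t ptq; rewrite /r normrM.
have {}mtx := mtx t ptq.
(* The factor 2 is the bound on [S]; the other factor bounds the rational part of [r]. *)
rewrite (_ : 4 * a / m ^+ 2 = 2 * (2 * a / m ^+ 2)); last by ring.
apply: ler_pM => //; rewrite normrM ger0_norm; last by rewrite mulr_ge0 ?ltW.
rewrite ler_pM2l ?mulr_gt0// normfV normrX lef_pV2 ?posrE ?exprn_gt0//.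
- by apply: lerXn2r; rewrite ?nnegrE ?(ltW m0) ?normr_ge0.
- by rewrite (lt_le_trans m0).
Qed.

(** * Amplitudes that are Hölder continuous of exponent one half *)

Variables (h : R -> R) (M : R).
Hypothesis hM : forall t, `|h t| <= M.
Hypothesis hN : forall s t, `|h s - h t| <= M * Num.sqrt `|s - t|.

Let M0 : 0 <= M. Proof. exact: le_trans (normr_ge0 (h 0)) (hM 0). Qed.

Lemma continuous_holder_half : continuous h.
Proof.
move=> s; apply/cvgrPdist_le => e e0.
(* [M] may be zero, so the radius is computed with [M + 1]. *)
have M1 : 0 < M + 1 by rewrite ltr_wpDl.
near=> t.
apply: (le_trans (hN _ _)).
have : `|s - t| <= (e / (M + 1)) ^+ 2.
  near: t; apply: cvgr_dist_le; first exact: cvg_id.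
  by rewrite exprn_gt0// divr_gt0.
rewrite -ler_sqrt ?sqr_ge0// sqrtr_sqr [`|e / _|]ger0_norm; last by rewrite divr_ge0 ?ltW.
rewrite ler_pdivlMr// => He; apply: le_trans He.
by rewrite mulrC ler_wpM2l ?sqrtr_ge0// lerDl.
Unshelve. all: by end_near. Qed.

Lemma continuous_hWqphase : continuous (fun t => h t * W (qphase t)).
Proof.
move=> t; apply: cvgM; first exact: continuous_holder_half.
exact: continuous_Wqphase.
Qed.

Lemma normr_hWqphase_le (t : R) : `|h t * W (qphase t)| <= M.
Proof. by rewrite normrM -[M]mulr1 ler_pM. Qed.

Lemma hWqphase_period (p q m : R) : p < q -> 0 < m ->
  (forall t, p <= t <= q -> m <= `|t - x|) ->
  S (qphase p) = 0 -> S (qphase q) = 0 ->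
  `|\int[mu]_(t in `[p, q]) (h t * W (qphase t))| <=
    M * (Num.sqrt (q - p) * (q - p) + 4 * a / m ^+ 2 * (q - p)).
Proof.
move=> pq m0 mtx Sp Sq.
(* Freeze [h] at the left endpoint: [g1] is small by the Hölder bound, and [g2] is a constant times
   the pure oscillation of [Wqphase_period]. *)
pose g1 t := (h t - h p) * W (qphase t).
pose g2 t := h p * W (qphase t).
have cWp : {within `[p, q], continuous (W \o qphase)}.
  by apply: continuous_subspaceT; exact: continuous_Wqphase.
have cg1 : {within `[p, q], continuous g1}.
  apply: continuous_subspaceT => t; apply: cvgM; last exact: continuous_Wqphase.
  by apply: cvgB; [exact: continuous_holder_half|exact: cvg_cst].
have cg2 : {within `[p, q], continuous g2}.
  apply: continuous_subspaceT => t; apply: cvgM; last exact: continuous_Wqphase.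
  exact: cvg_cst.
have -> : \int[mu]_(t in `[p, q]) (h t * W (qphase t)) =
          \int[mu]_(t in `[p, q]) g1 t + \int[mu]_(t in `[p, q]) g2 t.
  rewrite -RintegralD//; [|exact: integrable_itvcc..].
  by apply: eq_Rintegral => t _; rewrite /g1 /g2 -mulrDl subrK.
rewrite mulrDr; apply: (le_trans (ler_normD _ _)); apply: lerD.
  rewrite mulrA; apply: normr_Rintegral_le => //; first exact: ltW.
  move=> t /andP[pt tq]; rewrite normrM -[leRHS]mulr1 ler_pM//.
  apply: (le_trans (hN _ _)); rewrite ler_wpM2l// ler_wsqrtr//.
  by rewrite ger0_norm ?subr_ge0// lerB.
rewrite RintegralZl//; last exact: integrable_itvcc.
by rewrite normrM ler_pM// Wqphase_period.
Qed.

(** * Decomposition into full periods and telescoping *)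

Variable sigma : R.
Hypothesis sigma_gt0 : 0 < sigma.
Hypothesis sigma_sqr : sigma ^+ 2 = 8 * pi * a.

Let node (k : nat) : R := sigma * Num.sqrt k%:R.

Let node_sqr k : node k ^+ 2 = sigma ^+ 2 * k%:R.
Proof. by rewrite exprMn sqr_sqrtr ?ler0n. Qed.

Let node_gt0 k : 0 < node k.+1.
Proof. by rewrite mulr_gt0// sqrtr_gt0. Qed.

Let node_lt k : node k < node k.+1.
Proof. by rewrite ltr_pM2l// ltr_sqrt ?ltr0n// ltr_nat. Qed.

(** After squaring this is [k + 2 <= 4 * (k + 1)]. It lets [node_step] replace [P ^ 2] by [P * Q] in
    a denominator. *)
Let node_le2 k : node k.+2 <= 2 * node k.+1.
Proof.
have := ltW (node_gt0 k); have := ltW (node_gt0 k.+1) => ? ?.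
rewrite -ler_sqr ?nnegrE//; last exact: mulr_ge0.
rewrite [(2 * _) ^+ 2]exprMn !node_sqr.
have k1 : 1 <= k.+1%:R :> R by rewrite ler1n.
have s0 : 0 < sigma ^+ 2 by rewrite exprn_gt0.
by rewrite -[k.+2%:R]natr1; nra.
Qed.

Let S_node k : S (qphase (x + node k)) = 0 /\ S (qphase (x - node k)) = 0.
Proof.
have E : node k ^+ 2 / (4 * a) = k%:R * (2 * pi).
  by rewrite node_sqr sigma_sqr; field; rewrite gt_eqF.
by split; rewrite /qphase ?opprD ?opprK addrA subrr add0r ?sqrrN E S0.
Qed.

(* Writing [P, Q] for consecutive nodes, [(Q - P) * Q <= Q ^ 2 - P ^ 2 = sigma ^ 2],
   which turns both error terms of a period into telescoping differences. *)
Let node_step k P Q : P = node k.+1 -> Q = node k.+2 ->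
  Num.sqrt (Q - P) * (Q - P) + 4 * a / P ^+ 2 * (Q - P) <=
  2 * sigma * (Num.sqrt Q - Num.sqrt P) + sigma ^+ 2 * (P^-1 - Q^-1).
Proof.
move=> EP EQ.
have P0 : 0 < P by rewrite EP.
have PQ : P < Q by rewrite EP EQ.
have Q2P : Q <= 2 * P by rewrite EP EQ.
have Q0 : 0 < Q := lt_trans P0 PQ.
have QP : Q ^+ 2 - P ^+ 2 = sigma ^+ 2.
  by rewrite EP EQ !node_sqr -mulrBr -[k.+2%:R]natr1 addrC addKr mulr1.
apply: lerD.
  have st : Num.sqrt P < Num.sqrt Q by rewrite ltr_sqrt.
  have s0 : 0 < Num.sqrt P by rewrite sqrtr_gt0.
  have le_sig : Num.sqrt (Q - P) * Num.sqrt Q <= sigma.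
    rewrite -sqrtrM ?subr_ge0 ?(ltW PQ)// -[leRHS]ger0_norm ?(ltW sigma_gt0)//.
    rewrite -sqrtr_sqr.
    by rewrite ler_wsqrtr// -QP; nra.
  (* Factoring [Q - P] through square roots exposes the telescoping difference; the remaining factor
     is at most [2 * sigma] by [le_sig], as [P < Q]. *)
  have -> : Num.sqrt (Q - P) * (Q - P) = Num.sqrt (Q - P) *
      ((Num.sqrt Q + Num.sqrt P) * (Num.sqrt Q - Num.sqrt P)).
    congr (_ * _); rewrite -{1}(sqr_sqrtr (ltW Q0)) -{1}(sqr_sqrtr (ltW P0)).
    by ring.
  have := sqrtr_ge0 (Q - P); set w := Num.sqrt (Q - P) in le_sig * => w0.
  rewrite mulrA ler_wpM2r ?subr_ge0 ?(ltW st)//.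
  by nra.
have -> : P^-1 - Q^-1 = (Q - P) / (P * Q) by field; rewrite !gt_eqF.
have -> : 4 * a / P ^+ 2 * (Q - P) = (Q - P) / P * (4 * a / P).
  by field; rewrite gt_eqF.
have -> : sigma ^+ 2 * ((Q - P) / (P * Q)) = (Q - P) / P * (sigma ^+ 2 / Q).
  by field; rewrite !gt_eqF.
rewrite ler_wpM2l ?divr_ge0 ?subr_ge0 ?(ltW PQ) ?(ltW P0)//.
(* What is left is [4 * a * Q <= 8 * pi * a * P], which follows from [Q <= 2 * P] and [pi >= 2]. *)
rewrite ler_pdivrMr// mulrAC ler_pdivlMr// sigma_sqr.
have := pi_ge2 R; have aP : 0 < a * P by rewrite mulr_gt0.
by move: a0; nra.
Qed.

(** Induction on the number of periods, each new one paid for by [node_step]. The negative term is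
    kept so that the differences of inverses telescope exactly. *)
Lemma hWqphase_right k :
  `|\int[mu]_(t in `[x, x + node k.+1]) (h t * W (qphase t))| <=
  M * (2 * sigma + 2 * sigma * Num.sqrt (node k.+1) - sigma ^+ 2 / node k.+1).
Proof.
have node1 : node 1 = sigma by rewrite /node sqrtr1 mulr1.
have cont p q : {within `[p, q], continuous (fun t => h t * W (qphase t))}.
  exact: continuous_subspaceT continuous_hWqphase.
elim: k => [|k IH].
  (* The first period touches the stationary point [x], where integration by parts fails, so it is
     bounded by [M] times its length [sigma]. The leading [2 * sigma] of the bound covers this and
     the subtracted [sigma ^ 2 / node 1 = sigma]. *)
  rewrite node1; apply: le_trans (normr_Rintegral_le _ (cont _ _) _) _.
  - by rewrite lerDl ltW.
  - by move=> t _; exact: normr_hWqphase_le.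
  rewrite addrC addKr ler_wpM2l// expr2 mulfK ?gt_eqF//.
  by have := sqrtr_ge0 sigma; have := sigma_gt0; nra.
rewrite (@Rintegral_itvcc_cat _ _ (x + node k.+1)); last 3 first.
- exact: continuous_hWqphase.
- by rewrite lerDl ltW.
- by rewrite lerD2l ltW.
apply: le_trans (ler_normD _ _) _.
have lt12 : x + node k.+1 < x + node k.+2 by rewrite ltrD2l.
have dist t : x + node k.+1 <= t <= x + node k.+2 -> node k.+1 <= `|t - x|.
  by move=> /andP[+ _]; rewrite -lerBrDl => /le_trans; apply; exact: ler_norm.
have := hWqphase_period lt12 (node_gt0 k) dist (S_node k.+1).1 (S_node k.+2).1.
rewrite opprD addrACA subrr add0r => H.
apply: le_trans (lerD IH H) _.
rewrite -mulrDr ler_wpM2l//.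
have := @node_step k _ _ erefl erefl; lra.
Qed.

(** The same induction, with each new period attached at the left end of the segment. *)
Lemma hWqphase_left k :
  `|\int[mu]_(t in `[x - node k.+1, x]) (h t * W (qphase t))| <=
  M * (2 * sigma + 2 * sigma * Num.sqrt (node k.+1) - sigma ^+ 2 / node k.+1).
Proof.
have node1 : node 1 = sigma by rewrite /node sqrtr1 mulr1.
have cont p q : {within `[p, q], continuous (fun t => h t * W (qphase t))}.
  exact: continuous_subspaceT continuous_hWqphase.
elim: k => [|k IH].
  rewrite node1; apply: le_trans (normr_Rintegral_le _ (cont _ _) _) _.
  - by rewrite gerBl ltW.
  - by move=> t _; exact: normr_hWqphase_le.
  rewrite opprB addrC subrK ler_wpM2l// expr2 mulfK ?gt_eqF//.
  by have := sqrtr_ge0 sigma; have := sigma_gt0; nra.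
rewrite (@Rintegral_itvcc_cat _ _ (x - node k.+1)); last 3 first.
- exact: continuous_hWqphase.
- by rewrite lerD2l lerN2 ltW.
- by rewrite gerBl ltW.
rewrite addrC; apply: le_trans (ler_normD _ _) _.
have lt12 : x - node k.+2 < x - node k.+1 by rewrite ltrD2l ltrN2.
have dist t : x - node k.+2 <= t <= x - node k.+1 -> node k.+1 <= `|t - x|.
  rewrite distrC => /andP[_ tx]; apply: le_trans (ler_norm _).
  by rewrite lerBrDr -lerBrDl.
have := hWqphase_period lt12 (node_gt0 k) dist (S_node k.+2).2 (S_node k.+1).2.
have -> : x - node k.+1 - (x - node k.+2) = node k.+2 - node k.+1 by ring.
move=> H.
apply: le_trans (lerD IH H) _.
rewrite -mulrDr ler_wpM2l//.
have := @node_step k _ _ erefl erefl; lra.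
Qed.

Lemma integrable_hWqphase (D : R) : (forall t, D < `|t - x| -> h t = 0) ->
  mu.-integrable [set: R] (EFin \o (fun t => h t * W (qphase t))).
Proof.
move=> hD; have cont : {within `[x - D, x + D],
    continuous (fun t => h t * W (qphase t))}.
  exact: continuous_subspaceT continuous_hWqphase.
have := integrable_itvcc cont; rewrite integrable_mkcond//.
apply: eq_integrable => // t _; rewrite patchE; case: ifPn => //.
rewrite notin_setE/= in_itv/= => /negP tn; rewrite hD ?mul0r//.
by rewrite ltNge; apply: contra tn; rewrite ler_distl.
Qed.

Lemma Rintegral_hWqphase (D : R) : 0 <= D ->
  (forall t, D < `|t - x| -> h t = 0) ->
  `|\int[mu]_t (h t * W (qphase t))| <=
  4 * M * sigma * (1 + Num.sqrt (D + sigma)).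
Proof.
move=> D0 hD.
(* With this choice [node k <= D < node k.+1]: the segment covers the support of [h] and overshoots
   [D] by at most [sigma], because [node k.+1 ^ 2 <= D ^ 2 + sigma ^ 2]. *)
pose k := Num.trunc ((D / sigma) ^+ 2).
have Ds0 : 0 <= D / sigma by rewrite divr_ge0// ltW.
have /andP[kle klt] : k%:R <= (D / sigma) ^+ 2 < k.+1%:R.
  by rewrite truncn_itv// exprn_ge0.
have Dn : D < node k.+1.
  rewrite -ltr_pdivrMl// mulrC -[ltLHS]ger0_norm// -sqrtr_sqr ltr_sqrt//.
have nD : node k.+1 <= D + sigma.
  rewrite -ler_sqr ?nnegrE ?(ltW (node_gt0 _))//; last by rewrite addr_ge0// ltW.
  rewrite node_sqr -natr1 mulrDr mulr1.
  have : sigma ^+ 2 * k%:R <= D ^+ 2.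
    by rewrite -ler_pdivlMl ?exprn_gt0// mulrC -expr_div_n.
  have : 0 <= D * sigma by rewrite mulr_ge0// ltW.
  by lra.
have n0 := node_gt0 k.
have -> : \int[mu]_t (h t * W (qphase t)) =
          \int[mu]_(t in `[x - node k.+1, x + node k.+1]) (h t * W (qphase t)).
  rewrite [RHS]Rintegral_mkcond; apply: eq_Rintegral => t _.
  rewrite patchE; case: ifPn => //; rewrite notin_setE/= in_itv/= => /negP tn.
  rewrite hD ?mul0r// (lt_le_trans Dn)// leNgt; apply: contra tn.
  by rewrite ltr_distl => /andP[/ltW -> /ltW ->].
rewrite (@Rintegral_itvcc_cat _ _ x); last 3 first.
- exact: continuous_hWqphase.
- by rewrite gerBl ltW.
- by rewrite lerDl ltW.
apply: le_trans (ler_normD _ _) _.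
apply: le_trans (lerD (hWqphase_left k) (hWqphase_right k)) _.
rewrite -mulrDr [4 * M]mulrC -!mulrA ler_wpM2l//.
have : Num.sqrt (node k.+1) <= Num.sqrt (D + sigma) by rewrite ler_wsqrtr.
have : 0 <= sigma ^+ 2 / node k.+1 by rewrite divr_ge0 ?sqr_ge0 ?(ltW n0).
by move: sigma_gt0; nra.
Qed.

End quadratic_phase.
End oscillatory_integrals.

(** * The complex modulus and the Hölder norm *)

Section complex_modulus.
Variable R : realType.
Implicit Types (z w : R[i]) (f : R -> R[i]).

Lemma cmod_ge0 z : 0 <= cmod z.
Proof. by case: z => a b; exact: sqrtr_ge0. Qed.

Lemma normr_Re_le_cmod z : `|complex.Re z| <= cmod z.
Proof. by case: z => a b /=; rewrite -sqrtr_sqr ler_wsqrtr// lerDl sqr_ge0. Qed.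

Lemma normr_Im_le_cmod z : `|complex.Im z| <= cmod z.
Proof. by case: z => a b /=; rewrite -sqrtr_sqr ler_wsqrtr// lerDr sqr_ge0. Qed.

Lemma cmod_le_normr_ReIm z : cmod z <= `|complex.Re z| + `|complex.Im z|.
Proof.
case: z => a b /=; rewrite -[leRHS]ger0_norm ?addr_ge0// -sqrtr_sqr ler_wsqrtr//.
rewrite -(real_normK (num_real a)) -(real_normK (num_real b)).
by have := mulr_ge0 (normr_ge0 a) (normr_ge0 b); nra.
Qed.

Lemma cmod_cexpi (theta : R) : cmod (cexpi theta) = 1.
Proof. by rewrite /cmod /= cos2Dsin2 sqrtr1. Qed.

Lemma cmod_real (r : R) : 0 <= r -> cmod (Complex r 0) = r.
Proof. by move=> r0; rewrite /cmod /= expr0n addr0 sqrtr_sqr ger0_norm. Qed.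

Lemma supported_in_out (c d t : R) f : supported_in c d f ->
  `|c| + `|d| < `|t| -> f t = 0.
Proof.
move=> [c' [d' [cc' [d'd f0]]]] cdt; apply: f0.
have := ler_norm d; have := ler_norm (- c); rewrite normrN.
have := normr_ge0 c; have := normr_ge0 d.
move: cdt; case: (ger0P t) => t0; [right|left]; lra.
Qed.

Section Cs_norm_half.
Variables (c d : R) (f : R -> R[i]).
Hypothesis fC : in_Cs_c (2^-1) c d f.

Let supp_f t : `|c| + `|d| < `|t| -> f t = 0.
Proof. by case: fC => /supported_in_out + _; apply. Qed.

Let holder_f : exists2 K : R, 0 <= K &
  forall s t, cmod (f s - f t) <= K * Num.sqrt `|s - t|.
Proof.
case: fC => _ [K fK]; exists `|K| => // s t.
apply: le_trans (fK s t) _.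
by rewrite powR12_sqrt// ler_wpM2r ?sqrtr_ge0// ler_norm.
Qed.

(** A real [sup] dominates its set only once the set is known to be bounded, so boundedness must
    precede any use of [Cs_norm]; here it comes from comparing [f] with one of its zeros. *)
Let sup1 : has_sup [set cmod (f x) | x in [set: R]].
Proof.
have [K K0 fK] := holder_f.
split; first by exists (cmod (f 0)); exists 0.
(* A point outside the support, so that [f t = f t - f z] is controlled by the Hölder constant. *)
pose z := `|c| + `|d| + 1.
have z0 : 0 <= z by rewrite !addr_ge0.
exists (K * Num.sqrt (2 * z)) => _ [t _ <-].
have fz : f z = 0 by apply: supp_f; rewrite (ger0_norm z0) ltrDl.
have [tz|zt] := lerP `|t| z; last first.
  rewrite supp_f; last by apply: lt_trans zt; rewrite ltrDl.
  by rewrite /cmod ComplexField.Normc.normc0 mulr_ge0 ?sqrtr_ge0.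
rewrite -[f t]subr0 -fz; apply: le_trans (fK _ _) _.
rewrite ler_wpM2l// ler_wsqrtr//; apply: le_trans (ler_normB _ _) _.
by rewrite (ger0_norm z0); lra.
Qed.

Let hquot := [set cmod (f xy.1 - f xy.2) / (`|xy.1 - xy.2| `^ (2^-1)) |
  xy in [set xy : R * R | xy.1 != xy.2]].

Let sup2 : has_sup hquot.
Proof.
have [K K0 fK] := holder_f.
split.
  exists (cmod (f 0 - f 1) / (`|0 - 1| `^ (2^-1))); exists (0, 1) => //=.
  by rewrite eq_sym oner_eq0.
exists K => _ [[s t] /= st <-].
rewrite powR12_sqrt// ler_pdivrMr; first exact: fK.
by rewrite sqrtr_gt0 normr_gt0 subr_eq0.
Qed.

Let sup1_ge0 : 0 <= sup [set cmod (f x) | x in [set: R]].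
Proof.
apply: le_trans (cmod_ge0 (f 0)) _.
by apply: sup_upper_bound => //; exists 0.
Qed.

Let sup2_ge0 : 0 <= sup hquot.
Proof.
apply: (@le_trans _ _ (cmod (f 0 - f 1) / (`|0 - 1| `^ (2^-1)))).
  by rewrite divr_ge0 ?cmod_ge0 ?powR_ge0.
apply: sup_upper_bound => //; exists (0, 1) => //=.
by rewrite eq_sym oner_eq0.
Qed.

Lemma cmod_le_Cs_norm t : cmod (f t) <= Cs_norm (2^-1) f.
Proof.
apply: le_trans (_ : _ <= sup [set cmod (f x) | x in [set: R]]) _.
  by apply: sup_upper_bound => //; exists t.
by rewrite lerDl.
Qed.

Lemma holder_le_Cs_norm s t :
  cmod (f s - f t) <= Cs_norm (2^-1) f * Num.sqrt `|s - t|.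
Proof.
(* The diagonal is excluded from the set of quotients; there both sides vanish. *)
have [->|st] := eqVneq s t.
  by rewrite !subrr /cmod ComplexField.Normc.normc0 normr0 sqrtr0 mulr0.
have st0 : 0 < Num.sqrt `|s - t| by rewrite sqrtr_gt0 normr_gt0 subr_eq0.
rewrite -ler_pdivrMr// -powR12_sqrt//.
apply: le_trans (_ : _ <= sup hquot) _.
  by apply: sup_upper_bound => //; exists (s, t).
by rewrite lerDr.
Qed.

End Cs_norm_half.
End complex_modulus.

(** * Specialization to sine and cosine *)

Section trigonometric_phase.
Variable R : realType.
Local Notation mu := (@lebesgue_measure R).

Lemma sin_nat2pi (k : nat) : sin (k%:R * (2 * pi)) = 0 :> R.
Proof.
elim: k => [|k IH]; first by rewrite mul0r sin0.
by rewrite -natr1 mulrDl mul1r sinD IH mul0r add0r [2 * pi]mulr_natl sin2pi mulr0.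
Qed.

Lemma cos_nat2pi (k : nat) : cos (k%:R * (2 * pi)) = 1 :> R.
Proof.
elim: k => [|k IH]; first by rewrite mul0r cos0.
rewrite -natr1 mulrDl mul1r cosD IH sin_nat2pi mul0r subr0 mul1r [2 * pi]mulr_natl.
exact: cos2pi.
Qed.

Variables (h : R -> R) (M D x a : R).
Hypothesis a0 : 0 < a.
Hypothesis hM : forall t, `|h t| <= M.
Hypothesis hN : forall s t, `|h s - h t| <= M * Num.sqrt `|s - t|.
Hypothesis D0 : 0 <= D.
Hypothesis hD : forall t, D < `|t - x| -> h t = 0.

Let sigma := Num.sqrt (8 * pi * a).

Let bound W := mu.-integrable [set: R] (EFin \o (fun t => h t * W (qphase x a t)))
  /\ `|\int[mu]_t (h t * W (qphase x a t))|
       <= 4 * M * sigma * (1 + Num.sqrt (D + sigma)).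

Let bound_of (S W : R -> R) : (forall y : R, is_derive y 1 S (W y)) ->
  continuous W -> (forall y, `|W y| <= 1) -> (forall y, `|S y| <= 2) ->
  (forall k : nat, S (k%:R * (2 * pi)) = 0) -> bound W.
Proof.
move=> dS cW W1 S2 S0; split; first exact: integrable_hWqphase hD.
apply: (@Rintegral_hWqphase _ S W) => //.
- by rewrite sqrtr_gt0 !mulr_gt0// pi_gt0.
- by rewrite sqr_sqrtr// !mulr_ge0 ?pi_ge0 ?(ltW a0).
Qed.

Lemma cos_qphase_bound : bound cos.
Proof.
apply: (bound_of (S := sin)).
- exact: continuous_cos.
- by move=> y; rewrite ler_norml cos_geN1 cos_le1.
- move=> y; apply: (@le_trans _ _ 1); last by rewrite ler1n.
  by rewrite ler_norml sin_geN1 sin_le1.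
- exact: sin_nat2pi.
Qed.

(** The primitive [1 - cos] is chosen over [- cos] because it vanishes at the multiples of [2 * pi];
    this is why [S] is allowed the bound 2. *)
Lemma sin_qphase_bound : bound sin.
Proof.
apply: (bound_of (S := fun y => 1 - cos y)).
- by move=> y; apply: is_derive_eq; ring.
- exact: continuous_sin.
- by move=> y; rewrite ler_norml sin_geN1 sin_le1.
- by move=> y; rewrite ler_norml; have := cos_geN1 y; have := cos_le1 y; lra.
- by move=> k; rewrite cos_nat2pi subrr.
Qed.

End trigonometric_phase.

(** * Pointwise bounds on [La], uniform in [a] *)

Section La_bound.
Variable R : realType.
Local Notation mu := (@lebesgue_measure R).

Lemma cmod_cint_le (f : R -> R[i]) (c d x a : R) : 0 < a -> in_Cs_c (2^-1) c d f ->
  cmod (cint (fun t => f t * cexpi (- ((x - t) ^+ 2 / (4 * a))))) <=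
  16 * Cs_norm (2^-1) f * Num.sqrt (8 * pi * a) *
    (1 + Num.sqrt (`|x| + (`|c| + `|d|) + Num.sqrt (8 * pi * a))).
Proof.
move=> a0 fC; set sigma := Num.sqrt (8 * pi * a).
(* Beyond distance [D] from [x], a point has modulus larger than [|c| + |d|], hence lies outside the
   support of [f]. *)
set M := Cs_norm _ _; set D := `|x| + _.
have D0 : 0 <= D by rewrite !addr_ge0.
have fM t : cmod (f t) <= M := cmod_le_Cs_norm fC t.
have fN s t : cmod (f s - f t) <= M * Num.sqrt `|s - t| := holder_le_Cs_norm fC s t.
have f0 t : D < `|t - x| -> f t = 0.
  move=> Dt; apply: supported_in_out fC.1 _.
  by have := ler_normB t x; move: Dt; rewrite /D; lra.
pose f1 t := complex.Re (f t); pose f2 t := complex.Im (f t).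
have f1M t : `|f1 t| <= M := le_trans (normr_Re_le_cmod _) (fM t).
have f2M t : `|f2 t| <= M := le_trans (normr_Im_le_cmod _) (fM t).
have f1N s t : `|f1 s - f1 t| <= M * Num.sqrt `|s - t|.
  apply: le_trans (fN s t); apply: (le_trans _ (normr_Re_le_cmod _)).
  by rewrite /f1; case: (f s) (f t) => ? ? [? ?].
have f2N s t : `|f2 s - f2 t| <= M * Num.sqrt `|s - t|.
  apply: le_trans (fN s t); apply: (le_trans _ (normr_Im_le_cmod _)).
  by rewrite /f2; case: (f s) (f t) => ? ? [? ?].
have f10 t : D < `|t - x| -> f1 t = 0 by rewrite /f1 => /f0 ->.
have f20 t : D < `|t - x| -> f2 t = 0 by rewrite /f2 => /f0 ->.
(* Real and imaginary parts expand into four real integrals, each with constant 4, whence the 16. *)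
have [ic1 bc1] := cos_qphase_bound a0 f1M f1N D0 f10.
have [is1 bs1] := sin_qphase_bound a0 f1M f1N D0 f10.
have [ic2 bc2] := cos_qphase_bound a0 f2M f2N D0 f20.
have [is2 bs2] := sin_qphase_bound a0 f2M f2N D0 f20.
apply: le_trans (cmod_le_normr_ReIm _) _; rewrite /cint /=.
under eq_Rintegral => t _.
  rewrite (_ : complex.Re _ =
    f1 t * cos (qphase x a t) + f2 t * sin (qphase x a t)); last first.
    rewrite /f1 /f2 /qphase /cexpi; case: (f t) => ? ? /=.
    by rewrite cosN sinN mulrN opprK.
  over.
under [X in _ + `|X|]eq_Rintegral => t _.
  rewrite (_ : complex.Im _ =
    f2 t * cos (qphase x a t) - f1 t * sin (qphase x a t)); last first.
    rewrite /f1 /f2 /qphase /cexpi; case: (f t) => ? ? /=.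
    by rewrite cosN sinN mulrN addrC.
  over.
rewrite RintegralD// RintegralB//.
apply: le_trans (lerD (ler_normD _ _) (ler_normB _ _)) _.
apply: le_trans (lerD (lerD bc1 bs2) (lerD bc2 bs1)) _.
by rewrite -/sigma; lra.
Qed.

Lemma cmod_La_le (b : R -> R) (f : R -> R[i]) (c d u a : R) :
  0 <= a -> in_Cs_c (2^-1) c d f ->
  cmod (La b a f u) <= 32 * Cs_norm (2^-1) f *
    (1 + Num.sqrt (`|b a * u| + (`|c| + `|d|) + Num.sqrt (8 * pi * a))).
Proof.
move=> a_ge0 fC; have M0 : 0 <= Cs_norm (2^-1) f.
  exact: le_trans (cmod_ge0 (f 0)) (cmod_le_Cs_norm fC 0).
(* For [a = 0] the value is a value of [f], bounded by the norm itself. *)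
rewrite /La; case: ifPn => [_|an0].
  apply: le_trans (cmod_le_Cs_norm fC _) _.
  set q := Num.sqrt (_ + _); have : 0 <= q := sqrtr_ge0 _.
  by nra.
have a0 : 0 < a by rewrite lt_neqAle eq_sym an0.
have pi0 := pi_gt0 R.
have := cmod_cint_le (b a * u) a0 fC.
set sigma := Num.sqrt (8 * pi * a); set q := Num.sqrt (_ + sigma).
set I := cint _ => HI.
rewrite {1}/cmod !ComplexField.Normc.normcM -/(cmod _) -/(cmod I).
rewrite -!/(cmod _) cmod_cexpi !cmod_real ?invr_ge0 ?sqrtr_ge0//.
rewrite mulr1 -invfM -sqrtrM ?mulr_ge0 ?(ltW pi0)//.
set tau := Num.sqrt _.
have tau0 : 0 < tau by rewrite sqrtr_gt0 !mulr_gt0.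
(* The prefactor of [La] has modulus [tau^-1] with [tau ^ 2 = 4 * pi * a], while
   [sigma ^ 2 = 8 * pi * a]: the singularity at [a = 0] cancels, at the cost of a factor 2. *)
have sig_tau : sigma <= 2 * tau.
  rewrite -[leRHS]ger0_norm ?mulr_ge0 ?(ltW tau0)// -sqrtr_sqr ler_wsqrtr//.
  rewrite exprMn sqr_sqrtr ?mulr_ge0 ?(ltW pi0) ?(ltW a0)//.
  by have := mulr_gt0 pi0 a0; nra.
rewrite mulrC ler_pdivrMr//; apply: (le_trans HI).
have := ler_wpM2l (mulr_ge0 M0 (addr_ge0 ler01 (sqrtr_ge0 _ : 0 <= q))) sig_tau.
by nra.
Qed.

End La_bound.

(** Given the bound [cmod_La_le], it remains to dominate its right-hand side by a multiple of
    [Num.sqrt r], uniformly in [a] and in [u] with modulus at most [r]. *)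
Theorem theorem6 (R : realType) (c1 : R) (b : R -> R) (c d : R) :
  0 < c1 ->
  lipschitz_on_set `[0, c1]%classic b ->
  b 0 = 1 ->
  c < d ->
  exists C2 : R, 0 < C2 /\
    forall (r : R) (f : R -> R[i]),
      `|c| + `|d| < r ->
      in_Cs_c (2^-1) c d f ->
      (Linf_on r (maxLa b c1 f) <=
        (C2 * (1 + `|d - c|) * Num.sqrt r * Cs_norm (2^-1) f)%:E)%E.
Proof.
move=> c1_gt0 [L bL] b0 cd.
pose r0 := `|c| + `|d|.
(* As [c < d], the two endpoints are not both zero; this permits division by [r0] below. *)
have r0_gt0 : 0 < r0.
  rewrite /r0; have := ler_norm d; have := ler_norm (- c); rewrite normrN.
  by have := normr_ge0 c; have := normr_ge0 d; lra.
pose B := 1 + `|L| * c1.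
(* [B] bounds [b] on the interval. The three terms of [A], times [r], dominate [|b a * u|], [r0] and
   [Num.sqrt (8 * pi * a)], using [r0 < r]; the first term of [C2] turns 1 into a multiple of
   [Num.sqrt r]. *)
pose A := B + 1 + Num.sqrt (8 * pi * c1) / r0.
pose C2 := 32 * ((Num.sqrt r0)^-1 + Num.sqrt A).
have B_ge0 : 0 <= B by rewrite addr_ge0// mulr_ge0// ltW.
have A_ge0 : 0 <= A.
  by apply: addr_ge0; [exact: addr_ge0|rewrite divr_ge0 ?sqrtr_ge0 ?(ltW r0_gt0)].
have C2_gt0 : 0 < C2.
  by rewrite mulr_gt0// ltr_pwDl ?sqrtr_ge0// invr_gt0 sqrtr_gt0.
exists C2; split => // r f r0r fC.
have r_gt0 : 0 < r := lt_trans r0_gt0 r0r.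
have M0 : 0 <= Cs_norm (2^-1) f.
  exact: le_trans (cmod_ge0 (f 0)) (cmod_le_Cs_norm fC 0).
have bB a : 0 <= a <= c1 -> `|b a| <= B.
  move=> /andP[a0 ac1].
  have := bL a 0; rewrite /= !in_itv/= a0 ac1 lexx (ltW c1_gt0) b0 subr0.
  move=> /(_ isT isT) H.
  have := ler_normD (b a - 1) 1; rewrite subrK normr1 => /le_trans; apply.
  rewrite addrC lerD2l; apply: (le_trans H); rewrite (ger0_norm a0).
  apply: (@le_trans _ _ (`|L| * a)); first by rewrite ler_wpM2r// ler_norm.
  by rewrite ler_wpM2l.
have Lale u a : `|u| <= r -> 0 <= a <= c1 ->
    cmod (La b a f u) <= C2 * (1 + `|d - c|) * Num.sqrt r * Cs_norm (2^-1) f.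
  move=> ur /[dup] /bB baB /andP[a0 ac1].
  apply: le_trans (cmod_La_le _ _ a0 fC) _.
  rewrite -/r0; set q := Num.sqrt (_ + _).
  have q1 : 1 + q <= ((Num.sqrt r0)^-1 + Num.sqrt A) * Num.sqrt r.
    rewrite mulrDl; apply: lerD.
      by rewrite mulrC ler_pdivlMr ?sqrtr_gt0// mul1r ler_wsqrtr// ltW.
    rewrite -sqrtrM// ler_wsqrtr// [A * r]mulrDl [(B + 1) * r]mulrDl mul1r; apply: lerD.
      apply: lerD; last exact: ltW.
      by rewrite normrM ler_pM.
    rewrite [leRHS]mulrAC ler_pdivlMr//; apply: ler_pM; rewrite ?sqrtr_ge0 ?(ltW r0_gt0)//.
    - by rewrite ler_wsqrtr// ler_wpM2l// mulr_ge0 ?pi_ge0.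
    - exact: ltW.
  have q1' : 1 + q <= ((Num.sqrt r0)^-1 + Num.sqrt A) * (1 + `|d - c|) * Num.sqrt r.
    apply: (le_trans q1); rewrite ler_wpM2r ?sqrtr_ge0//.
    rewrite ler_peMr ?lerDl// addr_ge0 ?sqrtr_ge0// invr_ge0 sqrtr_ge0//.
  have := ler_wpM2l M0 q1'; rewrite /C2; lra.
(* The complement of the segment is null for the restricted measure, so the pointwise bound on the
   segment suffices. *)
apply/ess_supP; exists (~` `[- r, r]%classic); split.
- by apply: measurableC; exact: measurable_itv.
- by rewrite /= /mrestr setICl measure0.
move=> u /=; apply: contra_not; rewrite /= in_itv/= -ler_norml => ur.
apply: ge_ereal_sup => _ [a /= + <-]; rewrite in_itv/= => a01.
by rewrite lee_fin Lale.
Qed.
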